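(* Let $p$ be an autoregressive language model over a finite vocabulary $\mathcal{V}$ with horizon $T$, let $\bm{q}$ be a prompt, $\alpha>1$, $t\in\{0,\dots,T-1\}$, and let $\bm{x}_{0:t-1}$ be a partially generated sequence with $p(\bm{q},\bm{x}_{0:t-1})>0$. For $M_t\ge 2$ let $$\hat p^{(\mathrm{pow})}_{\alpha,\,\mathrm{JK}}(x_t\mid\bm{q},\bm{x}_{0:t-1})=M_t\,\hat p^{(\mathrm{pow})}_{\alpha}(x_t\mid\bm{q},\bm{x}_{0:t-1})-\frac{M_t-1}{M_t}\sum_{s=1}^{M_t}\hat p^{(\mathrm{pow})}_{\alpha,-s}(x_t)$$ be the jackknife estimator of the power distribution, where $\hat p^{(\mathrm{pow})}_{\alpha}$ is the Monte Carlo estimator based on $M_t$ sampled completions per token and $\hat p^{(\mathrm{pow})}_{\alpha,-s}$ is its leave-one-out version excluding the $s$-th completion of every token. Then, for every token $x_t\in\mathcal{V}$, as $M_t\to\infty$, $$\mathbb{E}\big[\hat p^{(\mathrm{pow})}_{\alpha,\,\mathrm{JK}}(x_t\mid\bm{q},\bm{x}_{0:t-1})\big]=p^{(\mathrm{pow})}_{\alpha}(x_t\mid\bm{q},\bm{x}_{0:t-1})+\mathcal{O}\!\left(\frac{1}{M_t^2}\right).$$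
   Context: $\mathcal{V}$ is a finite vocabulary and $T$ a fixed horizon; sequences are $\bm{x}_{0:T}\in\mathcal{V}^{T+1}$. An autoregressive language model $p$ assigns to the prompt $\bm{q}$ and every prefix $\bm{x}_{0:s-1}\in\mathcal{V}^{s}$, $0\le s\le T$, a probability distribution $p(\cdot\mid\bm{q},\bm{x}_{0:s-1})$ on $\mathcal{V}$. Block probabilities are given by the chain rule: $p(\bm{x}_{t+1:T}\mid\bm{q},\bm{x}_{0:t})=\prod_{s=t+1}^{T}p(x_s\mid\bm{q},\bm{x}_{0:s-1})$ and $p(\bm{q},\bm{x}_{0:t})=p(\bm{q})\prod_{s=0}^{t}p(x_s\mid\bm{q},\bm{x}_{0:s-1})$, with $p(\bm{q})>0$. Notation: $p^{\beta}(\cdot)=(p(\cdot))^{\beta}$; sums over $\bm{x}_{t+1:T}$ range over $\mathcal{V}^{T-t}$. The power distribution of the next token is $$p^{(\mathrm{pow})}_{\alpha}(x_t\mid\bm{q},\bm{x}_{0:t-1})=\frac{\sum_{\bm{x}_{t+1:T}}p^{\alpha}(\bm{q},\bm{x}_{0:t-1},x_t,\bm{x}_{t+1:T})}{\sum_{\bm{x}_{t:T}}p^{\alpha}(\bm{q},\bm{x}_{0:t-1},\bm{x}_{t:T})}.$$ Sampling: for each token $x'_t\in\mathcal{V}$, completions $\bm{x}^{[1]}_{t+1:T},\dots,\bm{x}^{[M_t]}_{t+1:T}$ (depending on $x'_t$, suppressed in the notation) are drawn i.i.d. from $p(\cdot\mid\bm{q},\bm{x}_{0:t-1},x'_t)$,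 and the completions for different tokens are independent. Expectation is over all these completions. Define $$\hat\zeta_t(x'_t)=\frac{1}{M_t}\sum_{r=1}^{M_t}p^{\alpha-1}(\bm{x}^{[r]}_{t+1:T}\mid\bm{q},\bm{x}_{0:t-1},x'_t),\qquad \hat\zeta^{(\mathrm{LOO})}_{t,-s}(x'_t)=\frac{1}{M_t-1}\sum_{r=1,\,r\ne s}^{M_t}p^{\alpha-1}(\bm{x}^{[r]}_{t+1:T}\mid\bm{q},\bm{x}_{0:t-1},x'_t),$$ $$\hat p^{(\mathrm{pow})}_\alpha(x_t\mid\bm{q},\bm{x}_{0:t-1})=\frac{p^\alpha(x_t\mid\bm{q},\bm{x}_{0:t-1})\,\hat\zeta_t(x_t)}{\sum_{x'_t\in\mathcal{V}}p^\alpha(x'_t\mid\bm{q},\bm{x}_{0:t-1})\,\hat\zeta_t(x'_t)},\qquad \hat p^{(\mathrm{pow})}_{\alpha,-s}(x_t)=\frac{p^\alpha(x_t\mid\bm{q},\bm{x}_{0:t-1})\,\hat\zeta^{(\mathrm{LOO})}_{t,-s}(x_t)}{\sum_{x'_t\in\mathcal{V}}p^\alpha(x'_t\mid\bm{q},\bm{x}_{0:t-1})\,\hat\zeta^{(\mathrm{LOO})}_{t,-s}(x'_t)}.$$ The constant in $\mathcal{O}(\cdot)$ may depend on everything ($p,\bm{q},\alpha,T,t,\mathcal{V}$, the prefix) except $M_t$. *)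

(* Defs.v *)
From HB Require Import structures.
From mathcomp Require Import all_boot all_order all_algebra.
From mathcomp Require Import all_classical all_reals all_analysis.

Set Implicit Arguments.
Unset Strict Implicit.
Unset Printing Implicit Defensive.

Import Order.TTheory GRing.Theory Num.Theory.
Import numFieldNormedType.Exports.

Local Open Scope classical_set_scope.
Local Open Scope ring_scope.

(* [next_prob p q x v] is p(v | q, x).  Prefixes are plain sequences over V and
   only those of size at most T are constrained. *)
Record arlm (R : realType) (V : finType) (Q : Type) (T : nat) := Arlm {
  prompt_prob : Q -> R;
  next_prob : Q -> seq V -> V -> R;
  prompt_prob_ge0 : forall q, 0 <= prompt_prob q;
  prompt_prob_le1 : forall q, prompt_prob q <= 1;
  next_prob_ge0 : forall q x v, (size x <= T)%N -> 0 <= next_prob q x v;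
  next_prob_sum1 : forall q x, (size x <= T)%N -> \sum_(v : V) next_prob q x v = 1
}.

Section Estimators.
Context (R : realType) (V : finType) (Q : Type) (T : nat).
Context (p : arlm R V Q T) (q : Q) (alpha : R).

(* p(y | q, x) for a block y of tokens following the prefix x *)
Definition block_prob (n : nat) (x : seq V) (y : n.-tuple V) : R :=
  \prod_(s < n) next_prob p q (x ++ take s y) (tnth y s).

(* p(q, y) *)
Definition joint_prob (n : nat) (y : n.-tuple V) : R :=
  prompt_prob p q * block_prob [::] y.

Section NextToken.
Context (t : nat) (x : t.-tuple V).

(* x_{t+1:T} has T - t tokens, x_{t:T} has (T - t).+1 *)
Definition pow_prob (v : V) : R :=
  (\sum_(y : (T - t).-tuple V) joint_prob [tuple of x ++ [tuple of v :: y]] `^ alpha) /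
  (\sum_(z : (T - t).+1.-tuple V) joint_prob [tuple of x ++ z] `^ alpha).

Definition completion_prob (v : V) (y : (T - t).-tuple V) : R :=
  block_prob (rcons x v) y.

Definition self_normalized (zeta : V -> R) (v : V) : R :=
  (next_prob p q x v `^ alpha * zeta v) /
  (\sum_(v' : V) next_prob p q x v' `^ alpha * zeta v').

Section MonteCarlo.
Context (M : nat) (c : V -> 'I_M -> (T - t).-tuple V).

Definition zeta_hat (v : V) : R :=
  M%:R^-1 * \sum_(r < M) completion_prob v (c v r) `^ (alpha - 1).

Definition zeta_loo (s : 'I_M) (v : V) : R :=
  (M%:R - 1)^-1 *
  \sum_(r < M | r != s) completion_prob v (c v r) `^ (alpha - 1).

Definition pow_hat (v : V) : R := self_normalized zeta_hat v.

Definition pow_loo (s : 'I_M) (v : V) : R := self_normalized (zeta_loo s) v.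

Definition pow_jackknife (v : V) : R :=
  M%:R * pow_hat v - (M%:R - 1) / M%:R * \sum_(s < M) pow_loo s v.

End MonteCarlo.
End NextToken.
End Estimators.

(* Mutual independence of a finite family of random elements of a finite
   (discrete) set; subfamilies are covered by taking B i := setT. *)
Definition mutually_independent (R : realType) (d : measure_display)
    (Omega : measurableType d) (P : probability Omega R) (I A : finType)
    (X : I -> Omega -> A) : Prop :=
  forall B : I -> set A,
    P (\bigcap_i (X i @^-1` B i)) = (\prod_(i : I) P (X i @^-1` B i))%E.

Record completion_sampling (R : realType) (V : finType) (Q : Type) (T : nat)
    (p : arlm R V Q T) (q : Q) (t : nat) (x : t.-tuple V) (M : nat)
    (d : measure_display) (Omega : measurableType d) (P : probability Omega R)
    (X : V -> 'I_M -> Omega -> (T - t).-tuple V) : Prop := CompletionSampling {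
  sampling_measurable : forall v r y, measurable (X v r @^-1` [set y]);
  sampling_law : forall v r y,
    P (X v r @^-1` [set y]) = (completion_prob p q x v y)%:E;
  sampling_indep : mutually_independent P (fun i : V * 'I_M => X i.1 i.2)
}.

(* Main.v *)
Require Import Defs.
From mathcomp Require Import all_boot all_order all_algebra.
From mathcomp Require Import all_classical all_reals all_analysis.
From mathcomp Require Import ring lra.
Import Order.TTheory GRing.Theory Num.Theory.
Import numFieldNormedType.Exports.
Set Implicit Arguments.
Unset Strict Implicit.
Local Open Scope classical_set_scope.
Local Open Scope ring_scope.

(** The estimator is a ratio [N / D] of sums of i.i.d. pairs, one pair per
    sampling round, with denominators positive almost surely. The leave-one-out
    estimators have the law of the estimator with one round less, so that the
    mean of the jackknife is [M E_M - (M - 1) E_(M-1)], where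
    [E_M = theta + E (S_M / D_M)], [theta] is the power distribution and [S] is a
    sum of centered terms [u].
    By exchangeability [E (S_M / D_M) = M E (u / (d + D_(M-1)))], with [(u, d)]
    independent of [D_(M-1)]; expanding in [d] and using that [u] is centered
    reduces this to the moments [H_k n = E (D_n ^- k)] for [k = 2, 3], up to
    deterministic errors since [D_n >= c n]. The jackknife difference then
    decays as [M ^- 2] because [H_3] varies slowly,
    [H_2 (n + 1) - H_2 n = - 2 delta H_3 n + O(n ^- 4)], and, again by
    exchangeability, [H_2 n = delta n H_3 n + O(n ^- 3)], with [delta = E d]. *)

(** * Sequences bounded by a multiple of [n ^- k] *)

Definition decays (R : realFieldType) (k : nat) (f : nat -> R) :=
  exists K, forall n, (0 < n)%N -> `|f n| * n%:R ^+ k <= K.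

Lemma eq_decays (R : realFieldType) k (f g : nat -> R) :
  (forall n, (0 < n)%N -> f n = g n) -> decays k f -> decays k g.
Proof. by move=> fg [K fK]; exists K => n n0; rewrite -fg// fK. Qed.

Lemma decaysD (R : realFieldType) k (f g : nat -> R) :
  decays k f -> decays k g -> decays k (fun n => f n + g n).
Proof.
move=> [K fK] [L gL]; exists (K + L) => n n0.
apply: le_trans (lerD (fK n n0) (gL n n0)).
by rewrite -mulrDl ler_wpM2r ?exprn_ge0// ler_normD.
Qed.

Lemma decaysZ (R : realFieldType) k (a : R) (f : nat -> R) :
  decays k f -> decays k (fun n => a * f n).
Proof.
move=> [K fK]; exists (`|a| * K) => n n0.
by rewrite normrM -mulrA ler_wpM2l// fK.
Qed.

(** A linear factor costs one order, since [n + a <= a.+1 * n] for positive [n]. *)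
Lemma decays_natM (R : realFieldType) k a (f : nat -> R) :
  decays k.+1 f -> decays k (fun n => (n%:R + a%:R) * f n).
Proof.
move=> [K fK]; exists (a.+1%:R * K) => n n0.
have na : n%:R + a%:R <= a.+1%:R * n%:R :> R.
  by rewrite -natrD -natrM ler_nat mulSn leq_add2l leq_pmulr.
apply: le_trans (ler_wpM2l (ler0n _ _) (fK n n0)).
rewrite normrM ger0_norm ?addr_ge0// exprS !mulrA ler_wpM2r ?exprn_ge0//.
by rewrite mulrAC ler_wpM2r// (le_trans na)// mulrC.
Qed.

Lemma decaysS (R : realFieldType) k (f : nat -> R) :
  decays k f -> decays k (fun n => f n.+1).
Proof.
move=> [K fK]; exists K => n n0; apply: le_trans (fK n.+1 isT).
by rewrite ler_wpM2l// lerXn2r ?nnegrE// ler_nat.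
Qed.

Lemma decays_sum (R : realFieldType) (I : finType) k (f : I -> nat -> R) :
  (forall i, decays k (f i)) -> decays k (fun n => \sum_i f i n).
Proof.
move=> fk; elim: (index_enum I) => [|i s IH].
  by exists 0 => n _; rewrite big_nil normr0 mul0r.
by apply: eq_decays (decaysD (fk i) IH) => n _; rewrite big_cons.
Qed.

Lemma decays_bigO (R : realType) k m (e : nat -> R) :
  decays k (fun n => e (m + n)%N) -> e =O_\oo (fun n : nat => (n%:R ^+ k)^-1 : R).
Proof.
(* The shift costs a factor [m.+1 ^ k] because [m + l <= m.+1 * l] for positive [l]; the final [+ 1]
   only makes the constant positive. *)
move=> [K eK]; apply/eqO_exP; exists (`|K| * m.+1%:R ^+ k + 1).
  by rewrite ltr_wpDl// mulr_ge0// exprn_ge0.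
near=> n.
have [l l0 ->] : exists2 l, (0 < l)%N & n = (m + l)%N.
  exists (n - m)%N; first by rewrite subn_gt0; near: n; exact: nbhs_infty_gt.
  by rewrite subnKC//; near: n; exact: nbhs_infty_ge.
have ml0 : 0 < (m + l)%:R :> R by rewrite ltr0n addn_gt0 l0 orbT.
rewrite normfV normrX gtr0_norm// ler_pdivlMr ?exprn_gt0//.
have ml : (m + l)%:R <= m.+1%:R * l%:R :> R.
  by rewrite -natrM ler_nat mulSn addnC leq_add2l leq_pmulr.
apply: le_trans (_ : `|e (m + l)%N| * (m.+1%:R * l%:R) ^+ k <= _).
  by rewrite ler_wpM2l// lerXn2r// nnegrE.
rewrite exprMn mulrCA mulrC.
apply: le_trans (_ : `|K| * m.+1%:R ^+ k <= _); last by rewrite lerDl.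
by rewrite ler_wpM2r ?exprn_ge0// (le_trans (eK l l0))// ler_norm.
Unshelve. all: by end_near.
Qed.

(** * Taylor remainders of inverse powers, all of order [z ^- 4] *)

Lemma invr_cube_shift_bound (R : realFieldType) (x z : R) : 0 < x -> 0 < z ->
  `|(x + z) ^- 3 - z ^- 3| * z ^+ 4 <= 3 * x.
Proof.
move=> x0 z0; have xz0 : 0 < x + z by rewrite addr_gt0.
have -> : (x + z) ^- 3 - z ^- 3 =
    - (x * (3 * z ^+ 2 + 3 * x * z + x ^+ 2) / ((x + z) ^+ 3 * z ^+ 3)).
  by field; rewrite !gt_eqF.
rewrite normrN ger0_norm; last first.
  apply: divr_ge0; last by rewrite mulr_ge0// exprn_ge0// ltW.
  by rewrite mulr_ge0 ?(ltW x0)//; nra.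
have -> : x * (3 * z ^+ 2 + 3 * x * z + x ^+ 2) / ((x + z) ^+ 3 * z ^+ 3) * z ^+ 4 =
    x * ((3 * z ^+ 2 + 3 * x * z + x ^+ 2) * z / (x + z) ^+ 3).
  by field; rewrite !gt_eqF.
rewrite mulrC ler_wpM2r ?(ltW x0)// ler_pdivrMr ?exprn_gt0//.
(* The gap between the two sides is a polynomial with nonnegative coefficients. *)
have -> : 3 * (x + z) ^+ 3 = (3 * z ^+ 2 + 3 * x * z + x ^+ 2) * z
   + (6 * x * z ^+ 2 + 8 * x ^+ 2 * z + 3 * x ^+ 3) by ring.
by rewrite lerDl !addr_ge0// !mulr_ge0// ?exprn_ge0 ?ltW.
Qed.

Lemma invr_shift_bound (R : realFieldType) (x z : R) : 0 < x -> 0 < z ->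
  `|(x + z)^-1 - z^-1 + x * z ^- 2 - x ^+ 2 * z ^- 3| * z ^+ 4 <= x ^+ 3.
Proof.
move=> x0 z0; have xz0 : 0 < x + z by rewrite addr_gt0.
have -> : (x + z)^-1 - z^-1 + x * z ^- 2 - x ^+ 2 * z ^- 3 =
    - (x ^+ 3 / (z ^+ 3 * (x + z))) by field; rewrite !gt_eqF.
rewrite normrN ger0_norm; last by rewrite divr_ge0 ?mulr_ge0// ?exprn_ge0 ?ltW.
have -> : x ^+ 3 / (z ^+ 3 * (x + z)) * z ^+ 4 = x ^+ 3 * (z / (x + z)).
  by field; rewrite !gt_eqF.
by rewrite ler_piMr ?exprn_ge0 ?(ltW x0)// ler_pdivrMr// mul1r lerDr ltW.
Qed.

Lemma invr_sqr_shift_bound (R : realFieldType) (x z : R) : 0 < x -> 0 < z ->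
  `|(x + z) ^- 2 - z ^- 2 + 2 * x * z ^- 3| * z ^+ 4 <= 3 * x ^+ 2.
Proof.
move=> x0 z0; have xz0 : 0 < x + z by rewrite addr_gt0.
have -> : (x + z) ^- 2 - z ^- 2 + 2 * x * z ^- 3 =
    x ^+ 2 * (3 * z + 2 * x) / ((x + z) ^+ 2 * z ^+ 3) by field; rewrite !gt_eqF.
rewrite ger0_norm; last first.
  by rewrite divr_ge0 ?mulr_ge0 ?addr_ge0 ?mulr_ge0// ?exprn_ge0 ?ltW.
have -> : x ^+ 2 * (3 * z + 2 * x) / ((x + z) ^+ 2 * z ^+ 3) * z ^+ 4 =
    (3 * z + 2 * x) * z / (x + z) ^+ 2 * x ^+ 2 by field; rewrite !gt_eqF.
rewrite ler_wpM2r ?exprn_ge0 ?(ltW x0)// ler_pdivrMr ?exprn_gt0//.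
have -> : 3 * (x + z) ^+ 2 = (3 * z + 2 * x) * z + (4 * x * z + 3 * x ^+ 2) by ring.
by rewrite lerDl addr_ge0 ?mulr_ge0 ?exprn_ge0 ?ltW.
Qed.

(** * Means over finite i.i.d. samples *)

Section IidMean.
Context (R : realFieldType) (B : finType) (w : B -> R).

Definition iid_mean (n : nat) (F : {ffun 'I_n -> B} -> R) : R :=
  \sum_(f : {ffun 'I_n -> B}) (\prod_i w (f i)) * F f.
Arguments iid_mean : clear implicits.

(** Samples of weight 0 are ignored, so that almost sure facts such as the positivity of a
    denominator suffice. *)
Lemma eq_iid_mean n (F G : {ffun 'I_n -> B} -> R) :
  (forall f : {ffun 'I_n -> B}, \prod_i w (f i) != 0 -> F f = G f) ->
  iid_mean n F = iid_mean n G.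
Proof.
move=> FG; apply: eq_bigr => f _.
by have [->|/FG ->//] := eqVneq (\prod_i w (f i)) 0; rewrite !mul0r.
Qed.

Lemma iid_meanD n (F G : {ffun 'I_n -> B} -> R) :
  iid_mean n (fun f => F f + G f) = iid_mean n F + iid_mean n G.
Proof. by rewrite -big_split; apply: eq_bigr => f _; rewrite mulrDr. Qed.

Lemma iid_meanZ n a (F : {ffun 'I_n -> B} -> R) :
  iid_mean n (fun f => a * F f) = a * iid_mean n F.
Proof. by rewrite mulr_sumr; apply: eq_bigr => f _; rewrite mulrCA. Qed.

Lemma iid_mean_sum n (I : finType) (F : I -> {ffun 'I_n -> B} -> R) :
  iid_mean n (fun f => \sum_i F i f) = \sum_i iid_mean n (F i).
Proof. by rewrite exchange_big; apply: eq_bigr => f _; rewrite mulr_sumr. Qed.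

(* Singling out any coordinate [r] gives the same right-hand side: this is both
   the recursion on [n] and the exchangeability of the coordinates. *)
Lemma iid_mean_lift n (r : 'I_n.+1) (G : B -> {ffun 'I_n -> B} -> R) :
  iid_mean n.+1 (fun f => G (f r) [ffun i => f (lift r i)]) =
  \sum_b w b * iid_mean n (G b).
Proof.
under [RHS]eq_bigr do rewrite mulr_sumr.
rewrite pair_big /=.
pose h (bf : B * {ffun 'I_n -> B}) : {ffun 'I_n.+1 -> B} :=
  [ffun j => if unlift r j is Some i then bf.2 i else bf.1].
rewrite /iid_mean (reindex h) /=; last first.
  exists (fun f => (f r, [ffun i => f (lift r i)])) => [[b f]|f] _.
    congr pair; first by rewrite ffunE unlift_none.
    by apply/ffunP => i; rewrite !ffunE liftK.
  by apply/ffunP => j; rewrite ffunE; case: unliftP => [i|] ->; rewrite ?ffunE.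
apply: eq_bigr => -[b f] _.
have hr : h (b, f) r = b by rewrite ffunE unlift_none.
have hl i : h (b, f) (lift r i) = f i by rewrite ffunE liftK.
rewrite (bigD1_ord r)//= hr mulrA; congr (_ * _ * G b _).
  by apply: eq_bigr => i _; rewrite hl.
by apply/ffunP => i; rewrite ffunE hl.
Qed.

Hypotheses (w_ge0 : forall b, 0 <= w b) (w_sum1 : \sum_b w b = 1).

Lemma iid_mean_cst n (K : R) : iid_mean n (fun=> K) = K.
Proof.
rewrite /iid_mean -mulr_suml -[RHS]mul1r; congr (_ * _).
by rewrite -(bigA_distr_bigA (fun (i : 'I_n) b => w b)) big1.
Qed.

Lemma ler_norm_iid_mean n (F : {ffun 'I_n -> B} -> R) (K : R) :
  (forall f, `|F f| <= K) -> `|iid_mean n F| <= K.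
Proof.
move=> FK; rewrite -(iid_mean_cst n K).
apply: le_trans (ler_norm_sum _ _ _) _; apply: ler_sum => f _.
have w0 : 0 <= \prod_i w (f i) by apply: prodr_ge0.
by rewrite normrM ger0_norm// ler_wpM2l.
Qed.

End IidMean.
Arguments iid_mean {R B} w n F.

(** * Bias of a ratio of i.i.d. sums *)

Section RatioEstimator.
Context (R : realFieldType) (B : finType) (w u d : B -> R).
Hypotheses (w_ge0 : forall b, 0 <= w b) (w_sum1 : \sum_b w b = 1).
Hypotheses (d_gt0 : forall b, 0 < d b) (u_centered : \sum_b w b * u b = 0).

Definition sample_total n (f : {ffun 'I_n -> B}) : R := \sum_i d (f i).

Definition total_mean n (phi : R -> R) : R :=
  iid_mean w n (fun f => phi (sample_total f)).

Lemma total_lift n (r : 'I_n.+1) (f : {ffun 'I_n.+1 -> B}) :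
  sample_total f = d (f r) + sample_total [ffun i => f (lift r i)].
Proof.
rewrite /sample_total (bigD1_ord r)//=; congr (_ + _).
by apply: eq_bigr => i _; rewrite ffunE.
Qed.

Lemma total_gt0 n (f : {ffun 'I_n -> B}) : (0 < n)%N -> 0 < sample_total f.
Proof.
case: n f => // n f _; rewrite (total_lift ord0) ltr_pwDl// sumr_ge0// => i _.
exact: ltW.
Qed.

Lemma total_ge : exists2 c : R, 0 < c &
  forall n (f : {ffun 'I_n -> B}), c * n%:R <= sample_total f.
Proof.
(* This constant lies below every [d b]; the added 1 makes the inverted sum positive without
   choosing an element of [B]. *)
exists (1 + \sum_b (d b)^-1)^-1.
  by rewrite invr_gt0 ltr_pwDl// sumr_ge0// => b _; rewrite invr_ge0 ltW.
move=> n f; rewrite -[n in n%:R]card_ord -sumr_const mulr_sumr.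
apply: ler_sum => i _; rewrite mulr1 -[leRHS]invrK lef_pV2 ?posrE ?invr_gt0//.
  rewrite (bigD1 (f i))//= addrCA lerDl addr_ge0// sumr_ge0// => b _.
  by rewrite invr_ge0 ltW.
by rewrite ltr_pwDl// sumr_ge0// => b _; rewrite invr_ge0 ltW.
Qed.

Lemma total_meanS n phi :
  total_mean n.+1 phi = \sum_b w b * total_mean n (fun z => phi (d b + z)).
Proof.
rewrite -(iid_mean_lift w ord0 (fun b f => phi (d b + sample_total f))).
by apply: eq_bigr => f _; rewrite (total_lift ord0).
Qed.

(** By exchangeability every summand [v (f r)] contributes the same mean, and the round singled out
    is independent of the total of the others. *)
Lemma iid_mean_sumM n (v : B -> R) phi :
  iid_mean w n.+1 (fun f => (\sum_i v (f i)) * phi (sample_total f)) =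
  n.+1%:R * \sum_b w b * v b * total_mean n (fun z => phi (d b + z)).
Proof.
transitivity (iid_mean w n.+1
    (fun f => \sum_r v (f r) * phi (d (f r) + sample_total [ffun i => f (lift r i)]))).
  apply: eq_iid_mean => f _; rewrite mulr_suml.
  by apply: eq_bigr => r _; rewrite (total_lift r).
rewrite iid_mean_sum -[n.+1 in RHS]card_ord -sumr_const mulr_suml.
apply: eq_bigr => r _; rewrite mul1r.
rewrite (iid_mean_lift w r (fun b f => v b * phi (d b + sample_total f))).
by apply: eq_bigr => b _; rewrite iid_meanZ mulrA.
Qed.

Lemma total_meanD n phi psi :
  total_mean n (fun z => phi z + psi z) = total_mean n phi + total_mean n psi.
Proof. exact: iid_meanD. Qed.

Lemma total_meanZ n a phi :
  total_mean n (fun z => a * phi z) = a * total_mean n phi.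
Proof. exact: iid_meanZ. Qed.

(** The total of [n] rounds is at least a fixed multiple of [n] on every sample, so a pointwise
    bound in [z] transfers to the mean without any concentration argument. *)
Lemma total_mean_decays k phi K :
  (forall z, 0 < z -> `|phi z| * z ^+ k <= K) -> decays k (fun n => total_mean n phi).
Proof.
move=> phiK; have [c c0 cT] := total_ge.
exists (c ^- k * K) => n n0; rewrite -ler_pdivlMr ?exprn_gt0 ?ltr0n//.
apply: ler_norm_iid_mean => // f; rewrite ler_pdivlMr ?exprn_gt0 ?ltr0n//.
rewrite ler_pdivlMl ?exprn_gt0// mulrCA -exprMn.
apply: le_trans (phiK _ (total_gt0 f n0)); rewrite ler_wpM2l//.
by rewrite lerXn2r ?nnegrE ?mulr_ge0 ?(ltW c0) ?(ltW (total_gt0 _ _))// cT.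
Qed.

Lemma weighted_total_mean_decays k (v : B -> R) (phi : B -> R -> R) (K : B -> R) :
  (forall b z, 0 < z -> `|phi b z| * z ^+ k <= K b) ->
  decays k (fun n => \sum_b v b * total_mean n (phi b)).
Proof.
by move=> phiK; apply: decays_sum => b; apply/decaysZ/total_mean_decays/phiK.
Qed.

Definition inv_mean k n := total_mean n (fun z => z ^- k).
Lemma inv_mean_decays k : decays k (inv_mean k).
Proof.
apply: (@total_mean_decays _ _ 1) => z z0.
by rewrite normfV normrX gtr0_norm// mulVf// expf_neq0// gt_eqF.
Qed.

(** Serves twice: the weights [w] produce increments of [inv_mean], and weights of sum 0 allow any
    [psi] independent of [b] to be subtracted for free. *)
Lemma sum_total_mean_sub (v : B -> R) (phi : B -> R -> R) psi n :
  \sum_b v b * total_mean n (fun z => phi b z - psi z) =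
  \sum_b v b * total_mean n (phi b) - (\sum_b v b) * total_mean n psi.
Proof.
rewrite mulr_suml -sumrB; apply: eq_bigr => b _; rewrite -mulrBr; congr (_ * _).
by rewrite -mulN1r -total_meanZ -total_meanD; apply: eq_iid_mean => f _; rewrite mulN1r.
Qed.

Lemma inv_meanS_sub k n :
  \sum_b w b * total_mean n (fun z => (d b + z) ^- k - z ^- k) =
  inv_mean k n.+1 - inv_mean k n.
Proof. by rewrite sum_total_mean_sub w_sum1 mul1r /inv_mean total_meanS. Qed.

Let delta := \sum_b w b * d b.

Lemma inv_mean3_step : decays 4 (fun n => inv_mean 3 n.+1 - inv_mean 3 n).
Proof.
under [X in decays _ X]boolp.eq_fun do rewrite -inv_meanS_sub.
apply: (@weighted_total_mean_decays _ _ _ (fun b => 3 * d b)) => b z z0.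
exact: invr_cube_shift_bound.
Qed.

(** The added round is independent of the previous total, so averaging the first-order expansion of
    [(d b + z) ^- 2] replaces [d b] by [delta] in the linear term. *)
Lemma inv_mean2_step :
  decays 4 (fun n => inv_mean 2 n.+1 - inv_mean 2 n + 2 * delta * inv_mean 3 n).
Proof.
apply: (@eq_decays _ _ (fun n => \sum_b w b *
    total_mean n (fun z => (d b + z) ^- 2 - z ^- 2 + 2 * d b * z ^- 3))).
  move=> n _; rewrite -inv_meanS_sub /delta [2 * _]mulr_sumr.
  rewrite [X in _ = _ + X]mulr_suml -big_split /=.
  apply: eq_bigr => b _; rewrite total_meanD total_meanZ /inv_mean; ring.
apply: (@weighted_total_mean_decays _ _ _ (fun b => 3 * d b ^+ 2)) => b z z0.
exact: invr_sqr_shift_bound.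
Qed.

(** Both terms are averages of [(d b + z) ^- 3], with weights [w b * d b] and [w b * delta]. The
    difference of the weights sums to 0, so [z ^- 3] can be subtracted, which gains one order. *)
Lemma inv_mean2_inv_mean3 :
  decays 3 (fun n => inv_mean 2 n.+1 - delta * n.+1%:R * inv_mean 3 n.+1).
Proof.
apply: (@eq_decays _ _ (fun n => (n%:R + 1%:R) * \sum_b (w b * (d b - delta)) *
    total_mean n (fun z => (d b + z) ^- 3 - z ^- 3))).
  move=> n _; rewrite sum_total_mean_sub.
  have -> : \sum_b w b * (d b - delta) = 0.
    under eq_bigr do rewrite mulrBr.
    by rewrite sumrB -mulr_suml w_sum1 mul1r subrr.
  rewrite mul0r subr0 -natrD addn1.
  (* Write [z ^- 2] as [z * z ^- 3] and expand the first factor as a sum over the rounds. *)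
  have -> : inv_mean 2 n.+1 =
      n.+1%:R * \sum_b w b * d b * total_mean n (fun z => (d b + z) ^- 3).
    rewrite -(iid_mean_sumM n d (fun z => z ^- 3)); apply: eq_iid_mean => f _.
    by rewrite -/(sample_total f); field; rewrite gt_eqF// total_gt0.
  have -> : delta * n.+1%:R * inv_mean 3 n.+1 =
      n.+1%:R * \sum_b w b * delta * total_mean n (fun z => (d b + z) ^- 3).
    rewrite mulrAC mulrC /inv_mean total_meanS; congr (_ * _).
    by rewrite mulr_sumr; apply: eq_bigr => b _; ring.
  by rewrite -mulrBr -sumrB; congr (_ * _); apply: eq_bigr => b _; ring.
apply/decays_natM/(@weighted_total_mean_decays _ _ _ (fun b => 3 * d b)) => b z z0.
exact: invr_cube_shift_bound.
Qed.

Definition ratio_mean n := iid_mean w n (fun f => (\sum_i u (f i)) / sample_total f).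

Let a := \sum_b w b * u b * d b.
Let c := \sum_b w b * u b * d b ^+ 2.
Let r n := \sum_b w b * u b *
  total_mean n (fun z => (d b + z)^-1 - z^-1 + d b * z ^- 2 - d b ^+ 2 * z ^- 3).

(** Second-order expansion of [(d b + z)^-1] in [d b], weighted by [u]: [a] and [c] collect the
    terms of order 1 and 2, [r] the remainder, and the term of order 0 vanishes because [u] is
    centered. *)
Lemma ratio_mean_expansion n :
  ratio_mean n.+1 = n.+1%:R * (r n - a * inv_mean 2 n + c * inv_mean 3 n).
Proof.
rewrite /ratio_mean (iid_mean_sumM n u (fun z => z^-1)); congr (_ * _).
transitivity (r n + \sum_b (w b * u b * total_mean n (fun z => z^-1)
   - w b * u b * d b * inv_mean 2 n + w b * u b * d b ^+ 2 * inv_mean 3 n)).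
  rewrite -big_split /=; apply: eq_bigr => b _.
  suff -> : total_mean n (fun z => (d b + z)^-1) = total_mean n (fun z =>
      (d b + z)^-1 - z^-1 + d b * z ^- 2 - d b ^+ 2 * z ^- 3)
      + total_mean n (fun z => z^-1) + (- d b) * inv_mean 2 n
      + d b ^+ 2 * inv_mean 3 n by ring.
  by rewrite -!total_meanZ -!total_meanD; apply: eq_iid_mean => f _; ring.
rewrite !big_split /= -!mulr_suml u_centered mul0r add0r sumrN -mulr_suml.
by rewrite addrA.
Qed.

(** For a sequence [A], the difference of [(n+3)^2 A(n+2)] and [(n+2)^2 A(n+1)] is [(n+3)^2 (A(n+2)
    - A(n+1)) + (2n+5) A(n+1)]. For [A = inv_mean 2] both pieces are only of order 1/n, but their
    leading parts cancel by the two relations between [inv_mean 2] and [inv_mean 3]. *)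
Lemma ratio_mean_diff :
  decays 2 (fun n => n.+3%:R * ratio_mean n.+3 - n.+2%:R * ratio_mean n.+2).
Proof.
have r4 : decays 4 r.
  apply: (@weighted_total_mean_decays _ _ _ (fun b => d b ^+ 3)) => b z z0.
  exact: invr_shift_bound.
have e4 := decaysS inv_mean2_step.
have e3 := inv_mean2_inv_mean3.
have D4 := decaysS inv_mean3_step.
have H3 := decaysS (inv_mean_decays 3).
have {}e4 := decays_natM 3 (decays_natM 3 e4).
have {}r4 := decaysD (decays_natM 3 (decays_natM 3 (decaysS (decaysS r4))))
  (decaysZ (-1) (decays_natM 2 (decays_natM 2 (decaysS r4)))).
have {}D4 := decays_natM 3 (decays_natM 3 D4).
(* The factor [2n+5] is split as [(n+2) + (n+3)]. *)
have {}e3 := decaysD (decays_natM 2 e3) (decays_natM 3 e3).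
have h3 := decaysD (decays_natM 2 H3) (decays_natM 3 H3).
(* What survives the cancellation: [2(n+3)^2 - (2n+5)(n+1) = 5n+13 = 2(n+2) + 3(n+3)]. *)
have h3' := decaysD (decaysZ 2 (decays_natM 2 H3)) (decaysZ 3 (decays_natM 3 H3)).
apply: eq_decays (decaysD (decaysD r4
  (decaysZ (- a) (decaysD (decaysD e4 e3) (decaysZ (- delta) h3'))))
  (decaysZ c (decaysD D4 h3))) => n _.
rewrite !ratio_mean_expansion -!natr1.
ring.
Qed.

End RatioEstimator.

(** * Expectations under finite product laws *)

Lemma expectation_indep_fin (R : realType) (d : measure_display)
    (Omega : measurableType d) (P : probability Omega R) (I A : finType)
    (X : I -> Omega -> A) (mu : I -> A -> R) (F : {ffun I -> A} -> R) :
  (forall i a, measurable (X i @^-1` [set a])) ->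
  (forall i a, P (X i @^-1` [set a]) = (mu i a)%:E) ->
  mutually_independent P X ->
  'E_P[fun w => F [ffun i => X i w]]%E =
  (\sum_(f : {ffun I -> A}) (\prod_i mu i (f i)) * F f)%:E.
Proof.
move=> mX lawX indX.
(* The events [E f] are the atoms of the joint sample: the integrand is constant on each, and
   independence factors their probabilities. *)
pose E (f : {ffun I -> A}) := \bigcap_i (X i @^-1` [set f i]).
have mE f : measurable (E f) by apply: fin_bigcap_measurable.
have PE f : P (E f) = (\prod_i mu i (f i))%:E.
  rewrite (indX (fun i => [set f i])) -prodEFin.
  by apply: eq_bigr => i _; exact: lawX.
have iE f : P.-integrable setT (fun w => (F f)%:E * (\1_(E f) w)%:E)%E.
  by apply: integrableZl => //; exact: integrable_indic.
rewrite unlock.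
transitivity (\int[P]_w (\sum_f (F f)%:E * (\1_(E f) w)%:E))%E.
  apply: eq_integral => w _; rewrite (bigD1 [ffun i => X i w])//=.
  rewrite indicE mem_set; last by move=> i _ /=; rewrite ffunE.
  rewrite mule1 big1 ?adde0// => f fX; rewrite indicE memNset ?mule0//.
  by move=> Ef; case/eqP: fX; apply/ffunP => i; rewrite ffunE (Ef i).
rewrite integral_sum// -sumEFin; apply: eq_bigr => f _.
rewrite integralZl//; last exact: integrable_indic.
by rewrite integral_indic// setIT; have := PE f => /= ->; rewrite muleC EFinM.
Qed.

Lemma sum_prod_marginal (R : comNzRingType) (I A : finType) (mu : I -> A -> R)
    (i0 : I) (G : A -> R) :
  (forall i, \sum_a mu i a = 1) ->
  \sum_(f : {ffun I -> A}) (\prod_i mu i (f i)) * G (f i0) = \sum_a mu i0 a * G a.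
Proof.
move=> mu1.
(* Attaching [G] to the factor of [i0] keeps a product, over which the sum distributes. *)
pose F i a := mu i a * (if i == i0 then G a else 1).
transitivity (\sum_(f : {ffun I -> A}) \prod_i F i (f i)).
  apply: eq_bigr => f _; rewrite /F big_split/=; congr (_ * _).
  by rewrite (bigD1 i0)//= eqxx big1 ?mulr1// => i /negbTE ->.
rewrite -(bigA_distr_bigA F) (bigD1 i0)//= [X in _ * X]big1 ?mulr1.
  by apply: eq_bigr => a _; rewrite /F eqxx.
by move=> i /negbTE ii0; under eq_bigr do rewrite /F ii0 mulr1; exact: mu1.
Qed.

(** * Chain rule and normalization of block probabilities *)

Lemma big_cons_tuple (R : nmodType) (V : finType) n (F : n.+1.-tuple V -> R) :
  \sum_z F z = \sum_v \sum_(y : n.-tuple V) F [tuple of v :: y].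
Proof.
rewrite pair_big /= (reindex (fun vy : V * n.-tuple V => [tuple of vy.1 :: vy.2]))//=.
exists (fun z => (thead z, [tuple of behead z])) => [[v y] _|z _] /=.
  by rewrite theadE; congr (_, _); apply: val_inj.
by rewrite -tuple_eta.
Qed.

Section BlockProbability.
Context (R : realType) (V : finType) (Q : Type) (T : nat).
Context (p : arlm R V Q T) (q : Q).

Lemma block_prob_cons n (x : seq V) v (y : n.-tuple V) :
  block_prob p q x [tuple of v :: y] = next_prob p q x v * block_prob p q (rcons x v) y.
Proof.
rewrite /block_prob big_ord_recl/= cats0; congr (_ * _).
apply: eq_bigr => s _; rewrite cat_rcons add0n.
by congr next_prob; rewrite (tnth_nth v) /= (tnth_nth v).
Qed.

Lemma block_prob_cat n m (x : seq V) (y : n.-tuple V) (z : m.-tuple V) :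
  block_prob p q x [tuple of y ++ z] = block_prob p q x y * block_prob p q (x ++ y) z.
Proof.
rewrite /block_prob big_split_ord; congr (_ * _); apply: eq_bigr => s _ /=.
  by rewrite tnth_lshift take_cat size_tuple ltn_ord.
rewrite tnth_rshift take_cat size_tuple ltnNge leq_addr/= addKn catA.
by [].
Qed.

(** The bound is [T.+1] and not [T] because the last token of the block is never conditioned on. *)
Lemma block_prob_ge0 n (x : seq V) (y : n.-tuple V) :
  (size x + n <= T.+1)%N -> 0 <= block_prob p q x y.
Proof.
move=> xn; apply: prodr_ge0 => s _; apply: next_prob_ge0.
rewrite size_cat size_take size_tuple ltn_ord -ltnS.
by rewrite (leq_trans _ xn)// ltn_add2l.
Qed.

Lemma sum_block_prob n (x : seq V) :
  (size x + n <= T.+1)%N -> \sum_(y : n.-tuple V) block_prob p q x y = 1.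
Proof.
elim: n x => [|n IH] x xn.
  rewrite (big_pred1 [tuple]); last by move=> y; apply/esym/eqP; exact: tuple0.
  by rewrite /block_prob big_ord0.
rewrite big_cons_tuple -[RHS](next_prob_sum1 p q (x := x)); last first.
  by rewrite -ltnS (leq_trans _ xn)// addnS ltnS leq_addr.
apply: eq_bigr => v _; under eq_bigr do rewrite block_prob_cons.
by rewrite -mulr_sumr IH ?mulr1// size_rcons addSnnS.
Qed.

End BlockProbability.

(** * The jackknife as a combination of ratio estimators *)

Lemma self_normalizedZ (R : realType) (V : finType) (Q : Type) (T : nat)
    (p : arlm R V Q T) (q : Q) (alpha : R) (t : nat) (x : t.-tuple V) (a : R)
    (zeta : V -> R) v : a != 0 ->
  self_normalized p q alpha x (fun v' => a * zeta v') v =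
  self_normalized p q alpha x zeta v.
Proof.
move=> a0; rewrite /self_normalized.
under eq_bigr do rewrite mulrCA.
by rewrite -mulr_sumr mulrCA -mulf_div divff// mul1r.
Qed.

Section JackknifeMean.
Context (R : realType) (V : finType) (Q : Type) (T : nat).
Context (p : arlm R V Q T) (q : Q) (alpha : R) (t : nat) (x : t.-tuple V) (xt : V).
Hypotheses (halpha : 1 < alpha) (ht : (t < T)%N)
  (hx : 0 < joint_prob p q x).

(* One sampling round draws a completion for every token, and each estimator is
   a ratio of sums over the rounds of [num] and [den]. *)
Let round := {ffun V -> (T - t).-tuple V}.

Let law (b : round) : R := \prod_v completion_prob p q x v (b v).
Let score v (y : (T - t).-tuple V) : R :=
  next_prob p q x v `^ alpha * completion_prob p q x v y `^ (alpha - 1).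
Let num (b : round) : R := score xt (b xt).
Let den (b : round) : R := \sum_v score v (b v).

Let size_x : (size x <= T)%N. Proof. by rewrite size_tuple ltnW. Qed.

Let size_xT v : (size (rcons x v) + (T - t) <= T.+1)%N.
Proof. by rewrite size_rcons size_tuple addSn subnKC// ltnW. Qed.

Let completion_prob_ge0 v y : 0 <= completion_prob p q x v y.
Proof. exact: block_prob_ge0. Qed.

Let law_ge0 b : 0 <= law b. Proof. exact: prodr_ge0. Qed.

Let law_sum1 : \sum_b law b = 1.
Proof.
rewrite -(bigA_distr_bigA (fun v y => completion_prob p q x v y)) big1// => v _.
exact: sum_block_prob.
Qed.

Let score_ge0 v y : 0 <= score v y.
Proof. by rewrite mulr_ge0 ?powR_ge0. Qed.

(** Some token has positive next-token probability, and its completion in a round of nonzero law has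
    positive probability too. *)
Let den_gt0 b : law b != 0 -> 0 < den b.
Proof.
move=> lb0.
have [v nv] : exists v, 0 < next_prob p q x v.
  apply: contrapT => n0.
  have /eqP := next_prob_sum1 p q size_x; rewrite big1 ?(eq_sym 0) ?oner_eq0// => v _.
  apply: contrapT => /eqP nv; apply: n0; exists v.
  by rewrite lt_neqAle eq_sym nv next_prob_ge0.
rewrite /den (bigD1 v)//= ltr_pwDl ?sumr_ge0// mulr_gt0 ?powR_gt0//.
rewrite lt_neqAle completion_prob_ge0 andbT eq_sym.
by apply: contraNneq lb0 => lb0; rewrite /law (bigD1 v)//= lb0 mul0r.
Qed.

Let pow_mass v := next_prob p q x v `^ alpha *
  \sum_(y : (T - t).-tuple V) completion_prob p q x v y `^ alpha.

(** The completions of the other tokens sum out, and sampling from [p] supplies the missing power: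
    [p * p^(alpha-1) = p^alpha], also where [p] is 0. *)
Let sum_law_score v : \sum_b law b * score v (b v) = pow_mass v.
Proof.
rewrite (sum_prod_marginal v (score v)); last by move=> i; exact: sum_block_prob.
rewrite /pow_mass mulr_sumr; apply: eq_bigr => y _.
by rewrite mulrCA mulr_powRB1// (lt_trans ltr01).
Qed.

(** The chain rule extracts the power of the prefix probability, which cancels because it is
    positive. *)
Let pow_probE : pow_prob p q alpha x xt = pow_mass xt / \sum_v pow_mass v.
Proof.
have jE v (y : (T - t).-tuple V) :
    joint_prob p q [tuple of x ++ [tuple of v :: y]] `^ alpha =
    joint_prob p q x `^ alpha *
    (next_prob p q x v `^ alpha * completion_prob p q x v y `^ alpha).
  have -> : joint_prob p q [tuple of x ++ [tuple of v :: y]] =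
      joint_prob p q x * (next_prob p q x v * completion_prob p q x v y).
    by rewrite /joint_prob block_prob_cat block_prob_cons mulrA.
  have nv : 0 <= next_prob p q x v by exact: next_prob_ge0.
  by rewrite powRM ?(ltW hx) ?mulr_ge0// powRM.
rewrite /pow_prob big_cons_tuple.
under eq_bigr do rewrite jE.
under [X in _ / X]eq_bigr do under eq_bigr do rewrite jE.
under [X in _ / X]eq_bigr do rewrite -!mulr_sumr.
rewrite -!mulr_sumr -mulf_div divff ?mul1r//.
by rewrite gt_eqF// powR_gt0.
Qed.

(** The numerator left when the target is subtracted from [num / den]; it has mean 0 because the
    target is the ratio of the means. *)
Let centered b := num b - pow_prob p q alpha x xt * den b.

Let sum_law_den : \sum_b law b * den b = \sum_v pow_mass v.
Proof.
under eq_bigr do rewrite mulr_sumr.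
by rewrite exchange_big; apply: eq_bigr => v _; exact: sum_law_score.
Qed.

Let centered_mean0 : \sum_b law b * centered b = 0.
Proof.
have D0 : \sum_v pow_mass v != 0.
  have : exists b, 0 < law b * den b.
    have [b lb0] : exists b, law b != 0.
      apply: contrapT => l0; have /eqP := law_sum1.
      rewrite big1 ?(eq_sym 0) ?oner_eq0// => b _.
      by apply: contrapT => /eqP lb; apply: l0; exists b.
    by exists b; rewrite mulr_gt0 ?den_gt0// lt_neqAle eq_sym lb0 law_ge0.
  move=> [b lb]; rewrite -sum_law_den (bigD1 b)//= gt_eqF// ltr_pwDl// sumr_ge0//.
  move=> b' _; have [->|/den_gt0 db] := eqVneq (law b') 0; first by rewrite mul0r.
  by rewrite mulr_ge0// ltW.
rewrite /centered; under eq_bigr do rewrite mulrBr [X in _ - X]mulrCA.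
by rewrite sumrB -mulr_sumr sum_law_den sum_law_score pow_probE divfK// subrr.
Qed.

(* Rounds of probability 0 may have [den] equal to 0. *)
Let posden b := if law b == 0 then 1 else den b.

Let posden_gt0 b : 0 < posden b.
Proof. by rewrite /posden; case: eqVneq => // /den_gt0. Qed.

Let ratio n (g : {ffun 'I_n -> round}) := (\sum_r num (g r)) / \sum_r den (g r).

Let iid_mean_ratio n : (0 < n)%N ->
  iid_mean law n (@ratio n) =
  pow_prob p q alpha x xt + ratio_mean law centered posden n.
Proof.
move=> n0.
have <- : iid_mean law n (fun=> pow_prob p q alpha x xt) = pow_prob p q alpha x xt.
  by rewrite iid_mean_cst.
rewrite -iid_meanD; apply: eq_iid_mean => g g0.
have law_g r : law (g r) != 0.
  by apply: contraNneq g0 => gr; rewrite (bigD1 r)//= gr mul0r.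
have dE : sample_total posden g = \sum_r den (g r).
  by apply: eq_bigr => r _; rewrite /posden (negbTE (law_g r)).
have D0 : \sum_r den (g r) != 0 by rewrite -dE gt_eqF// total_gt0.
by rewrite dE sumrB mulrBl -[X in _ - X / _]mulr_sumr mulfK// addrC subrK.
Qed.

(** The prefactors of [zeta_hat] and [zeta_loo] cancel, so both estimators become ratios of sums
    over the retained rounds. *)
Let self_normalized_scores (I : finType) (S : pred I) (g : I -> round) a : a != 0 ->
  self_normalized p q alpha x
    (fun v => a * \sum_(r | S r) completion_prob p q x v (g r v) `^ (alpha - 1)) xt =
  (\sum_(r | S r) num (g r)) / \sum_(r | S r) den (g r).
Proof.
move=> a0; rewrite self_normalizedZ// /self_normalized; congr (_ / _).
  by rewrite mulr_sumr.
by under eq_bigr do rewrite mulr_sumr; rewrite exchange_big.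
Qed.

(** Removing any one round leaves [n.+1] i.i.d. rounds, so all leave-one-out means agree; the target
    keeps the coefficient [n.+2 - n.+1 = 1]. *)
Lemma iid_mean_jackknife n :
  iid_mean law n.+2 (fun g => pow_jackknife p q alpha x (fun v r => g r v) xt) =
  pow_prob p q alpha x xt + (n.+2%:R * ratio_mean law centered posden n.+2 -
    n.+1%:R * ratio_mean law centered posden n.+1).
Proof.
have n2 : n.+2%:R != 0 :> R by rewrite pnatr_eq0.
have n1 : n.+2%:R - 1 = n.+1%:R :> R by rewrite -[n.+2%:R]natr1 addrK.
transitivity (n.+2%:R * iid_mean law n.+2 (@ratio n.+2)
    - n.+1%:R / n.+2%:R * \sum_(s < n.+2) iid_mean law n.+1 (@ratio n.+1)).
  under [X in _ - _ * X]eq_bigr => s _.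
    (* The factor 1, written as the total mass of [law], reinserts the excluded round. *)
    rewrite -[iid_mean _ _ _]mul1r -law_sum1 mulr_suml.
    rewrite -(iid_mean_lift law s (fun=> @ratio n.+1)).
    over.
  rewrite -iid_mean_sum -mulNr -!iid_meanZ -iid_meanD.
  apply: eq_iid_mean => g _; rewrite /pow_jackknife n1 mulNr.
  congr (_ * _ - _ * _).
    by rewrite /pow_hat /zeta_hat self_normalized_scores ?invr_eq0.
  apply: eq_bigr => s _; rewrite /pow_loo /zeta_loo n1.
  rewrite self_normalized_scores ?invr_eq0 ?pnatr_eq0//.
  have loo (F : round -> R) :
      \sum_(r < n.+2 | r != s) F (g r) =
      \sum_(i < n.+1) F ([ffun i => g (lift s i)] i).
    apply: (addrI (F (g s))); transitivity (\sum_r F (g r)).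
      by rewrite [RHS](bigD1 s).
    rewrite (bigD1_ord s)//=; congr (_ + _).
    by apply: eq_bigr => i _; rewrite ffunE.
  by rewrite (loo num) (loo den).
rewrite sumr_const card_ord !iid_mean_ratio//.
by field.
Qed.

(** The independent completions, indexed by token and round, are regrouped into i.i.d. rounds. *)
Lemma jackknife_sampling_mean n (d : measure_display) (Omega : measurableType d)
    (P : probability Omega R) (X : V -> 'I_n -> Omega -> (T - t).-tuple V) :
  completion_sampling p q x P X ->
  'E_P[fun w => pow_jackknife p q alpha x (fun v r => X v r w) xt]%E =
  (iid_mean law n (fun g => pow_jackknife p q alpha x (fun v r => g r v) xt))%:E.
Proof.
move=> [mX lawX indX].
pose F (f : {ffun V * 'I_n -> (T - t).-tuple V}) :=
  pow_jackknife p q alpha x (fun v r => f (v, r)) xt.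
rewrite (_ : (fun w => _) = fun w => F [ffun i => X i.1 i.2 w]); last first.
  apply/funext => w; rewrite /F; congr pow_jackknife.
  by apply/funext => v; apply/funext => r; rewrite ffunE.
rewrite (expectation_indep_fin (mu := fun i => completion_prob p q x i.1))//.
rewrite /iid_mean (reindex (fun g : {ffun 'I_n -> round} =>
  [ffun i : V * 'I_n => g i.2 i.1])) /=.
  congr _%:E; apply: eq_bigr => g _; congr (_ * _).
    rewrite /law [RHS]exchange_big [RHS]pair_big.
    by apply: eq_bigr => i _; rewrite ffunE.
  rewrite /F; congr pow_jackknife.
  by apply/funext => v; apply/funext => r; rewrite ffunE.
exists (fun f => [ffun r => [ffun v => f (v, r)]]) => [g|f] _.
  by apply/ffunP => r; apply/ffunP => v; rewrite !ffunE.
by apply/ffunP => -[v r]; rewrite !ffunE.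
Qed.

Lemma jackknife_bias : exists e : nat -> R,
  decays 2 (fun n => e n.+3) /\
  forall n, iid_mean law n.+2
      (fun g => pow_jackknife p q alpha x (fun v r => g r v) xt) =
    pow_prob p q alpha x xt + e n.+2.
Proof.
exists (fun n => n%:R * ratio_mean law centered posden n -
  n.-1%:R * ratio_mean law centered posden n.-1); split.
  exact: ratio_mean_diff.
exact: iid_mean_jackknife.
Qed.

End JackknifeMean.

Theorem lemma3p3 (R : realType) (V : finType) (Q : Type) (T : nat)
    (p : arlm R V Q T) (q : Q) (alpha : R) (t : nat) (x : t.-tuple V)
    (hq : 0 < prompt_prob p q) (halpha : 1 < alpha) (ht : (t < T)%N)
    (hx : 0 < joint_prob p q x)
    (d : nat -> measure_display) (Omega : forall M : nat, measurableType (d M))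
    (P : forall M : nat, probability (Omega M) R)
    (X : forall M : nat, V -> 'I_M -> Omega M -> (T - t).-tuple V)
    (hX : forall M : nat, (2 <= M)%N -> completion_sampling p q x (P M) (X M))
    (xt : V) :
  exists e : nat -> R,
    (forall M : nat, (2 <= M)%N ->
      'E_(P M)[fun w : Omega M =>
                 pow_jackknife p q alpha x (fun v r => X M v r w) xt]%E =
      (pow_prob p q alpha x xt + e M)%:E) /\
    e =O_\oo (fun M : nat => (M%:R ^+ 2)^-1 : R).
Proof.
have [e [e_decays eE]] := jackknife_bias xt halpha ht hx.
(* The shift 3 matches the range of the decay bound, as [3 + n] computes to [n.+3]. *)
exists e; split; last exact: (decays_bigO (m := 3)).
by case=> [|[|n]]// _; rewrite (jackknife_sampling_mean _ _ (hX n.+2 _)) ?eE.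
Qed.
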